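(* Let $G=(V,E)$ be a finite biconnected graph, possibly with multi-edges, but no self-loops. Then either (i) $G$ is strictly dense, or (ii) $G$ admits a minimal core $H_0\subsetneq G$. Moreover, in case (ii): (a) $H_0$ has the fair restriction property with respect to $G$, meaning that for every fair tree $\gamma$ of $G$, the restriction $\gamma\cap H_0$ is a spanning tree of $H_0$; (b) for any fair tree $\gamma$ of $G$, the projection of $\gamma\setminus H_0$ onto the shrunk graph $G/H_0$ is a fair spanning tree of $G/H_0$; (c) fair trees of the core $H_0$ can be coupled with fair trees of the shrunk graph $G/H_0$ to produce fair trees of $G$, i.e. for every fair tree $\gamma_1$ of $H_0$ and every fair tree $\gamma_2$ of $G/H_0$, the union $\gamma_1\cup\gamma_2$ (with edges of $G/H_0$ identified with edges of $G$) is a fair tree of $G$.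
   Context: $G$ has at least one edge. Biconnected means vertex-biconnected (connected with no articulation vertex). For a connected graph $K$, $\mathcal{S}(K)$ is the family of all connected subgraphs $H=(V_H,E_H)$ of $K$ with $|E_H|\ge1$ that are edge-induced, i.e. obtained by removing all edges of $K$ not in $E_H$ and deleting any vertices of degree zero. The density is $\theta(H)=|E_H|/(|V_H|-1)$. A connected graph $K$ is strictly dense if $\theta(H)<\theta(K)$ for all $H\in\mathcal{S}(K)$ with $H\ne K$. A subgraph $H\in\mathcal{S}(G)$ is a minimal core for $G$ if $\theta(H)=\max_{H'\in\mathcal{S}(G)}\theta(H')$ and every $H''\in\mathcal{S}(H)$ with $H''\neq H$ satisfies $\theta(H'')<\theta(H)$. The shrunk graph $G/H$ is obtained by identifying all vertices of $H$ to a single vertex $v_H$, removing all resulting self-loops but keeping all resulting multi-edges. Fair trees: for a finite connected multigraph $K$ with set of spanning trees $\Gamma_K$ (viewed as edge sets), the minimum expected overlap (MEO) problem is to minimize $\sum_{\gamma,\gamma'\in\Gamma_K}\mu(\gamma)\mu(\gamma')|\gamma\cap\gamma'|$ over all probability mass functions $\mu$ on $\Gamma_K$. Optimal pmfs exist but need not be unique. A spanning tree $\gamma\in\Gamma_K$ is a fair tree of $K$ if there exists an optimal pmf $\mu^*$ for the MEO problem on $K$ with $\mu^*(\gamma)>0$. *)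

(* Defs.v *)
From HB Require Import structures.
From mathcomp Require Import all_boot all_order all_algebra.
From mathcomp Require Import boolp reals.

Set Implicit Arguments.
Unset Strict Implicit.
Unset Printing Implicit Defensive.

Import Order.TTheory GRing.Theory Num.Theory.
Local Open Scope ring_scope.

(** Finite multigraphs, with vertices and edges named in ambient finite types
    [V] and [E].  The orientation given by [src] and [tgt] is a mere encoding
    of the unordered pair of ends of an edge.  Keeping the edge names in an
    ambient type makes the edges of a subgraph, or of a shrunk graph, literally
    edges of the original graph. *)
Record mgraph (V E : finType) := MGraph {
  verts : {set V};
  edges : {set E};
  src : E -> V;
  tgt : E -> V;
  endsP : forall e, e \in edges -> (src e \in verts) && (tgt e \in verts)
}.

Definition loopless (V E : finType) (K : mgraph V E) : bool :=
  [forall e in edges K, src K e != tgt K e].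

Definition joins (V E : finType) (K : mgraph V E) (e : E) (x y : V) : bool :=
  ((src K e == x) && (tgt K e == y)) || ((src K e == y) && (tgt K e == x)).

Definition adj (V E : finType) (K : mgraph V E) : rel V :=
  fun x y => [exists e in edges K, joins K e x y].

Definition connected (V E : finType) (K : mgraph V E) : bool :=
  (verts K != set0) &&
  [forall x in verts K, forall y in verts K, connect (adj K) x y].

Lemma del_vertex_ends (V E : finType) (K : mgraph V E) (v : V) (e : E) :
  e \in [set e in edges K | (src K e != v) && (tgt K e != v)] ->
  (src K e \in verts K :\ v) && (tgt K e \in verts K :\ v).
Proof.
by rewrite !inE => /and3P[/endsP/andP[-> ->] -> ->].
Qed.

Definition del_vertex (V E : finType) (K : mgraph V E) (v : V) : mgraph V E :=
  MGraph (@del_vertex_ends V E K v).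

Definition articulation (V E : finType) (K : mgraph V E) (v : V) : bool :=
  [exists x in verts K :\ v, exists y in verts K :\ v,
     connect (adj K) x y && ~~ connect (adj (del_vertex K v)) x y].

Definition biconnected (V E : finType) (K : mgraph V E) : bool :=
  connected K && [forall v in verts K, ~~ articulation K v].

Lemma esub_ends (V E : finType) (K : mgraph V E) (F : {set E}) (e : E) :
  e \in F :&: edges K ->
  let W := (src K @: (F :&: edges K)) :|: (tgt K @: (F :&: edges K)) in
  (src K e \in W) && (tgt K e \in W).
Proof. by move=> eF /=; rewrite !inE !imset_f ?orbT. Qed.

(** Edge-induced subgraph: its vertices are the ends of the edges in [F]. *)
Definition esub (V E : finType) (K : mgraph V E) (F : {set E}) : mgraph V E :=
  MGraph (@esub_ends V E K F).

Lemma span_ends (V E : finType) (K : mgraph V E) (F : {set E}) (e : E) :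
  e \in F :&: edges K -> (src K e \in verts K) && (tgt K e \in verts K).
Proof. by rewrite inE => /andP[_ /endsP]. Qed.

(** Spanning subgraph: all the vertices of [K] are kept. *)
Definition span_sub (V E : finType) (K : mgraph V E) (F : {set E}) :
  mgraph V E := MGraph (@span_ends V E K F).

(** The family S(K); an edge-induced subgraph is represented by its edge set,
    the subgraph itself being [esub K F].  For connected [K] with an edge,
    [K] itself is represented by [edges K]. *)
Definition conn_subs (V E : finType) (K : mgraph V E) : {set {set E}} :=
  [set F : {set E} | [&& F \subset edges K, (1 <= #|F|)%N
                       & connected (esub K F)]].

Definition density (V E : finType) (K : mgraph V E) : rat :=
  #|edges K|%:R / (#|verts K|%:R - 1).

Definition strictly_dense (V E : finType) (K : mgraph V E) : Prop :=
  connected K /\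
  forall F, F \in conn_subs K -> F <> edges K ->
    density (esub K F) < density K.

Definition minimal_core (V E : finType) (G : mgraph V E) (H : {set E}) : Prop :=
  [/\ H \in conn_subs G,
      forall F, F \in conn_subs G -> density (esub G F) <= density (esub G H)
    & forall F, F \in conn_subs (esub G H) -> F <> H ->
        density (esub (esub G H) F) < density (esub G H)].

(** In [option V], [None] is the vertex v_H. *)
Definition collapse (V E : finType) (G : mgraph V E) (H : {set E}) (v : V) :
  option V := if v \in verts (esub G H) then None else Some v.

Lemma shrink_ends (V E : finType) (G : mgraph V E) (H : {set E}) (e : E) :
  e \in [set e in edges G |
          collapse G H (src G e) != collapse G H (tgt G e)] ->
  (collapse G H (src G e) \in collapse G H @: verts G) &&
  (collapse G H (tgt G e) \in collapse G H @: verts G).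
Proof. by rewrite inE => /andP[/endsP/andP[? ?] _]; rewrite !imset_f. Qed.

Definition shrink (V E : finType) (G : mgraph V E) (H : {set E}) :
  mgraph (option V) E := MGraph (@shrink_ends V E G H).

(** A cycle (v_0, e_0), ..., (v_(k-1), e_(k-1)) has distinct vertices and
    distinct edges, e_i joining v_i to v_(i+1 mod k).  A self-loop is a cycle
    of length 1 and two parallel edges form a cycle of length 2. *)
Definition is_cycle (V E : finType) (K : mgraph V E) (c : seq (V * E)) : bool :=
  [&& c != [::], uniq (unzip1 c), uniq (unzip2 c),
      all (fun e => e \in edges K) (unzip2 c)
    & cycle (fun p q => joins K p.2 p.1 q.1) c].

Definition is_tree (V E : finType) (K : mgraph V E) : Prop :=
  connected K /\ forall c, ~~ is_cycle K c.

Definition spanning_tree (V E : finType) (K : mgraph V E) (g : {set E}) : Prop :=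
  g \subset edges K /\ is_tree (span_sub K g).

Definition spanning_trees (V E : finType) (K : mgraph V E) : {set {set E}} :=
  [set g : {set E} | `[< spanning_tree K g >]].

(** Only the values of [mu] on spanning trees of [K] are relevant. *)
Definition tree_pmf (R : realType) (V E : finType) (K : mgraph V E)
    (mu : {set E} -> R) : Prop :=
  (forall g, g \in spanning_trees K -> 0 <= mu g) /\
  \sum_(g in spanning_trees K) mu g = 1.

Definition expected_overlap (R : realType) (V E : finType) (K : mgraph V E)
    (mu : {set E} -> R) : R :=
  \sum_(g in spanning_trees K) \sum_(g' in spanning_trees K)
     mu g * mu g' * #|g :&: g'|%:R.

Definition meo_optimal (R : realType) (V E : finType) (K : mgraph V E)
    (mu : {set E} -> R) : Prop :=
  tree_pmf K mu /\
  forall nu : {set E} -> R, tree_pmf K nu ->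
    expected_overlap K mu <= expected_overlap K nu.

Definition fair_tree (R : realType) (V E : finType) (K : mgraph V E)
    (g : {set E}) : Prop :=
  g \in spanning_trees K /\
  exists mu : {set E} -> R, meo_optimal K mu /\ 0 < mu g.

Definition fair_restriction (R : realType) (V E : finType) (G : mgraph V E)
    (H : {set E}) : Prop :=
  forall g, fair_tree R G g -> spanning_tree (esub G H) (g :&: H).

(* Main.v *)
From mathcomp Require Import classical_sets topology normedtype derive.
Require Import Defs.
From mathcomp Require Import all_boot all_order all_algebra.
From mathcomp Require Import ring lra.
From mathcomp Require Import boolp reals.

Set Implicit Arguments.
Unset Strict Implicit.
Unset Printing Implicit Defensive.

Import Order.TTheory GRing.Theory Num.Theory.

(** Let [eta e] be the probability that the random tree with law [mu] contains
    the edge [e] ([usage]).  The expected overlap of [mu] is the sum of the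
    squares of the [eta e] ([expected_overlapE]), a convex function of [mu].
    Moving a small mass from a tree of the support to another tree shows that,
    for an optimal [mu], the trees of the support have minimal weight for the
    edge weights [eta] ([meo_min_weight]); hence an edge on the path of such a
    tree that joins the ends of [e] has usage at most [eta e]
    ([meo_exchange]).

    Let [m] be the least usage and [C] a component of the set of the edges of
    usage [m].  By the exchange property every tree of the support spans [C]
    ([min_usage_component]), so that [m * #|C| = #|V_C| - 1]: the number [m] is
    the inverse of the density of [C].  If [H] is a densest connected subgraph
    then [m * #|H| >= #|V_H| - 1], so a random tree has on average at least
    [#|V_H| - 1] edges in [H].  As no tree has more, every tree of the support
    restricts to a spanning tree of [H] ([support_spans_densest]); this is the
    fair restriction property.

    The spanning trees of [G] that restrict to spanning trees of [H] are the
    unions of a spanning tree of [H] and a spanning tree of the shrunk graph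
    ([spanning_tree_shrink], [union_spanning_tree]).  The expected overlap of
    a law on such trees is the sum of the overlaps of its two images
    ([overlap_split]), and likewise for the product of a law on the trees of
    [H] and a law on the trees of the shrunk graph ([overlap_product]).
    Replacing the second image of an optimal law by a better one would improve
    the whole, which gives the statement on projections.  For the coupling
    statement, an optimal law on [G] exists by compactness
    ([meo_optimal_exists]); both its images have overlaps at least the optimal
    ones, so the product of two optimal laws is optimal.

    The dichotomy only needs a densest connected subgraph with as few edges as
    possible ([minimal_core_exists]): it is a minimal core, and it is the whole
    graph exactly when the graph is strictly dense. *)

(** * Forests and connected edge sets *)

Section EdgeSets.
Variables (V E : finType) (s t : E -> V).
Implicit Types (F S : {set E}) (W : {set V}) (e f : E) (x y z : V).

(** Adjacency by an edge of [F], whatever its orientation. *)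
Definition link F : rel V := fun x y =>
  [exists e in F, ((s e == x) && (t e == y)) || ((s e == y) && (t e == x))].

(** [linked F x y]: a walk with edges in [F] leads from [x] to [y]. *)
Definition linked F : rel V := connect (link F).

(** A forest is an edge set [F] in which every edge is a bridge. *)
Definition forest F : bool := [forall e in F, ~~ linked (F :\ e) (s e) (t e)].

(** All the ends of the edges in [F] lie in [W]. *)
Definition inside F W : bool := [forall e in F, (s e \in W) && (t e \in W)].

(** [F] connects any two vertices of [W]. *)
Definition links F W : bool :=
  [forall x in W, forall y in W, linked F x y].

Lemma insideP F W :
  reflect (forall e, e \in F -> s e \in W /\ t e \in W) (inside F W).
Proof.
apply: (iffP forall_inP) => h e /h; first by move/andP.
by case=> -> ->.
Qed.

Lemma linksP F W :
  reflect (forall x y, x \in W -> y \in W -> linked F x y) (links F W).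
Proof.
apply: (iffP forall_inP) => [h x y xW yW | h x xW].
  exact: (forall_inP (h x xW)).
by apply/forall_inP => y; apply: h.
Qed.

Lemma link_sym F : symmetric (link F).
Proof. by move=> x y; apply: eq_existsb => e; rewrite orbC. Qed.

Lemma linkedC F x y : linked F x y = linked F y x.
Proof. exact: sym_connect_sym (link_sym F) x y. Qed.

Lemma linked_refl F x : linked F x x.
Proof. exact: connect0. Qed.

Lemma linked_trans F y x z : linked F x y -> linked F y z -> linked F x z.
Proof. exact: connect_trans. Qed.

Lemma linked_edge F e : e \in F -> linked F (s e) (t e).
Proof. by move=> eF; apply/connect1/existsP; exists e; rewrite eF !eqxx. Qed.

Lemma linked_ind F (P : V -> Prop) x y :
  (forall e, e \in F -> P (s e) <-> P (t e)) -> P x -> linked F x y -> P y.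
Proof.
move=> hP Px /connectP[p pth ->]; elim: p x Px pth => //= z p IH x Px.
case/andP=> /exists_inP[e eF /orP[]/andP[/eqP es /eqP et]].
  by apply: IH; rewrite -et; apply/(hP e eF); rewrite es.
by apply: IH; rewrite -es; apply/(hP e eF); rewrite et.
Qed.

Lemma linked_subrel F F' x y :
  (forall e, e \in F -> linked F' (s e) (t e)) -> linked F x y -> linked F' x y.
Proof.
move=> h; apply: (@linked_ind F (linked F' x)) (linked_refl F' x) => e /h et.
by split=> /linked_trans; apply=> //; rewrite linkedC.
Qed.

Lemma linkedS F F' x y : F \subset F' -> linked F x y -> linked F' x y.
Proof. by move=> /subsetP sF; apply: linked_subrel => e /sF/linked_edge. Qed.

Lemma linked_edge_r F e x : e \in F -> linked F x (s e) = linked F x (t e).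
Proof.
move=> /linked_edge h; apply/idP/idP => /linked_trans; apply => //.
by rewrite linkedC.
Qed.

Lemma linkedU1 F f x y : linked (f |: F) x y ->
  [|| linked F x y, linked F x (s f) && linked F (t f) y
    | linked F x (t f) && linked F (s f) y].
Proof.
apply: (@linked_ind (f |: F) (fun y => [|| linked F x y,
  linked F x (s f) && linked F (t f) y | linked F x (t f) && linked F (s f) y]));
  last by rewrite linked_refl.
move=> e.
rewrite !inE => /orP[/eqP-> | eF].
  rewrite !linked_refl !andbT.
  by case: (linked F x (s f)); case: (linked F x (t f)).
by rewrite !(linked_edge_r _ eF).
Qed.

(** A walk in [F] can either avoid [f] or be cut at [f] into two walks that
    avoid it. *)
Lemma linkedD1 F f x y : f \in F -> linked F x y ->
  [|| linked (F :\ f) x y, linked (F :\ f) x (s f) && linked (F :\ f) (t f) y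
    | linked (F :\ f) x (t f) && linked (F :\ f) (s f) y].
Proof. by move=> fF; rewrite -{1}(setD1K fF) => /linkedU1. Qed.

Lemma forestS F F' : F \subset F' -> forest F' -> forest F.
Proof.
move=> sF /forall_inP h; apply/forall_inP => e eF.
by apply: contra (h e (subsetP sF e eF)); apply/linkedS/setSD.
Qed.

Lemma insideS F F' W : F \subset F' -> inside F' W -> inside F W.
Proof. by move=> /subsetP sF /insideP h; apply/insideP => e /sF/h. Qed.

Lemma linked_inside F W x y : inside F W -> x \in W -> linked F x y -> y \in W.
Proof.
move=> /insideP h; apply: (@linked_ind F (fun z => z \in W)) => e /h[-> ->].
by [].
Qed.

(** A walk that starts in a union [W] of components of [F] only uses edges of
    these components. *)
Lemma linked_restrict F W x y :
  (forall e, e \in F -> (s e \in W) = (t e \in W)) -> x \in W ->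
  linked F x y -> linked [set e in F | s e \in W] x y.
Proof.
move=> hW xW xy; suff /andP[]: (y \in W) && linked [set e in F | s e \in W] x y.
  by [].
apply: (@linked_ind F (fun y => (y \in W) && linked [set e in F | s e \in W] x y))
  xy; last by rewrite xW linked_refl.
move=> e eF; rewrite -hW //; case sW: (s e \in W) => //=.
by rewrite (@linked_edge_r _ e) // inE eF sW.
Qed.

(** It takes at least [#|W| - 1] edges to connect [W]. *)
Lemma leq_card_links F W : links F W -> (#|W| <= #|F|.+1)%N.
Proof.
move=> /linksP hF; case: (set_0Vmem W) => [->|[x0 x0W]]; first by rewrite cards0.
(* grow, from [x0], a set with at least as many inner edges as new vertices *)
suff [X [xX WX Xle]] : exists X : {set V}, [/\ x0 \in X, W \subset X &
    (#|X| <= #|[set e in F | (s e \in X) && (t e \in X)]|.+1)%N].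
  apply: leq_trans (subset_leq_card WX) (leq_trans Xle _).
  by rewrite ltnS subset_leq_card //; apply/subsetP => e; rewrite inE => /andP[].
pose P (X : {set V}) := (x0 \in X) &&
  (#|X| <= #|[set e in F | (s e \in X) && (t e \in X)]|.+1)%N.
have P0 : P [set x0] by rewrite /P set11 cards1.
have [X /maxsetP[/andP[xX Xle] mX] _] := maxset_exists P0.
exists X; split => //; apply/subsetP => y yW.
apply: contraT => yX.
have : y \in X; last by rewrite (negPf yX).
apply: (@linked_ind F (fun z => z \in X) x0) (hF _ _ x0W yW) => // e eF.
suff h u v : (u == s e) && (v == t e) || (u == t e) && (v == s e) ->
    u \in X -> v \in X.
  by split; apply: h; rewrite !eqxx ?orbT.
move=> uv uX; apply: contraT => vX.
have : v |: X = X.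
  apply: mX; last exact: subsetUr.
  rewrite /P !inE xX orbT /= cardsU1 vX add1n ltnS.
  apply: (leq_trans Xle).
  have <- : #|e |: [set e in F | (s e \in X) && (t e \in X)]| =
     #|[set e in F | (s e \in X) && (t e \in X)]|.+1.
    rewrite cardsU1 inE eF.
    by case/orP: uv => /andP[/eqP <- /eqP <-]; rewrite (negPf vX) ?andbF ?add1n.
  apply: subset_leq_card; apply/subsetP => f; rewrite !inE.
  case/orP=> [/eqP-> | /and3P[-> -> ->]]; last by rewrite !orbT.
  by case/orP: uv => /andP[/eqP <- /eqP <-]; rewrite eF uX eqxx /= ?orbT.
by move=> eX; rewrite -eX !inE eqxx in vX.
Qed.

Lemma card_cut F (A : {set V}) :
  (#|F| = #|[set e in F | s e \in A]| + #|[set e in F | s e \notin A]|)%N.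
Proof.
rewrite -(cardsID [set e | s e \in A] F); congr (_ + _)%N.
  by apply: eq_card => e; rewrite !inE.
by apply: eq_card => e; rewrite !inE andbC.
Qed.

Lemma ltn_card_forest F W :
  W != set0 -> inside F W -> forest F -> (#|F| < #|W|)%N.
Proof.
have [n] := ubnP #|F|; elim: n F W => // n IH F W leFn W0 insF forF.
have [->|[e eF]] := set_0Vmem F; first by rewrite cards0 card_gt0.
(* deleting [e] splits [W] into the component [A] of [s e] and the rest *)
pose A := [set x in W | linked (F :\ e) (s e) x].
have insF' := insideS (subsetDl F [set e]) insF.
have forF' := forestS (subsetDl F [set e]) forF.
have [sW tW] := insideP _ _ insF e eF.
have clA f : f \in F :\ e -> (s f \in A) = (t f \in A).
  by move=> fF; rewrite !inE (linked_edge_r _ fF); have [-> ->] := insideP _ _ insF' f fF.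
have sA : s e \in A by rewrite inE sW linked_refl.
have tA : t e \in W :\: A.
  by rewrite !inE tW /= andbT; apply: (forall_inP forF).
have cF : #|F| = #|F :\ e|.+1 by rewrite (cardsD1 e) eF.
rewrite cF (card_cut (F :\ e) A) -(cardsID A W) (_ : W :&: A = A); last first.
  by apply/setIidPr/subsetP => x; rewrite inE => /andP[].
have sub1 : [set f in F :\ e | s f \in A] \subset F :\ e.
  by apply/subsetP => f; rewrite inE => /andP[].
have sub2 : [set f in F :\ e | s f \notin A] \subset F :\ e.
  by apply/subsetP => f; rewrite inE => /andP[].
rewrite -addSn -addnS leq_add //.
  apply: IH; [|by apply/set0Pn; exists (s e)| |exact: forestS sub1 forF'].
    by apply: leq_ltn_trans (subset_leq_card sub1) _; rewrite -ltnS -cF.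
  by apply/insideP => f; rewrite inE => /andP[fF fA]; rewrite -clA.
apply: IH; [|by apply/set0Pn; exists (t e)| |exact: forestS sub2 forF'].
  by apply: leq_ltn_trans (subset_leq_card sub2) _; rewrite -ltnS -cF.
apply/insideP => f; rewrite inE => /andP[fF fA].
by have [? ?] := insideP _ _ insF' f fF; rewrite !in_setD -clA // fA; split.
Qed.

Lemma forest_links_card F W : W != set0 -> inside F W -> forest F ->
  links F W -> #|F|.+1 = #|W|.
Proof.
by move=> W0 iF fF lF; apply/eqP; rewrite eqn_leq ltn_card_forest //= leq_card_links.
Qed.

Lemma links_card_forest F W :
  inside F W -> links F W -> #|F|.+1 = #|W| -> forest F.
Proof.
move=> iF /linksP lF cF; apply/forall_inP => e eF; apply/negP => le.
have : links (F :\ e) W.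
  apply/linksP => x y xW yW; apply: linked_subrel (lF x y xW yW) => f fF.
  by have [->|fe] := eqVneq f e => //; apply: linked_edge; rewrite !inE fe.
by move/leq_card_links; rewrite -cF (cardsD1 e F) eF ltnn.
Qed.

Lemma forest_card_links F W :
  inside F W -> forest F -> #|F|.+1 = #|W| -> links F W.
Proof.
move=> iF fF cF; apply/linksP => x y xW yW; apply: contraT => nxy.
pose A := [set z in W | linked F x z].
have clA f : f \in F -> (s f \in A) = (t f \in A).
  by move=> fF'; rewrite !inE (linked_edge_r _ fF'); have [-> ->] := insideP _ _ iF f fF'.
have sub1 : [set f in F | s f \in A] \subset F.
  by apply/subsetP => f; rewrite inE => /andP[].
have sub2 : [set f in F | s f \notin A] \subset F.
  by apply/subsetP => f; rewrite inE => /andP[].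
have l1 : (#|[set f in F | s f \in A]| < #|A|)%N.
  apply: ltn_card_forest (forestS sub1 fF).
    by apply/set0Pn; exists x; rewrite inE xW linked_refl.
  by apply/insideP => f; rewrite inE => /andP[fF' fA]; rewrite -clA.
have l2 : (#|[set f in F | s f \notin A]| < #|W :\: A|)%N.
  apply: ltn_card_forest (forestS sub2 fF).
    by apply/set0Pn; exists y; rewrite !inE yW (negPf nxy).
  apply/insideP => f; rewrite inE => /andP[fF' fA].
  by have [? ?] := insideP _ _ iF f fF'; rewrite !in_setD -clA // fA; split.
have := leq_add l1 l2; rewrite addSn addnS -card_cut.
have := cardsID A W; rewrite (_ : W :&: A = A); last first.
  by apply/setIidPr/subsetP => z; rewrite inE => /andP[].
by move=> ->; rewrite -cF ltnn.
Qed.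

(** If two vertices are linked by the forest [F], but not by its part [S],
    then their path in [F] has an edge outside [S]. *)
Lemma forest_separating_edge F S x y : forest F -> linked F x y ->
  ~~ linked S x y -> exists2 f, f \in F :\: S & ~~ linked (F :\ f) x y.
Proof.
move=> fF lF nS.
have [P /minsetP[/andP[PF lP] mP] _] :=
  @minset_exists _ (fun P => (P \subset F) && linked P x y) F
    (introT andP (conj (subxx F) lF)).
have [f fP fS] : exists2 f, f \in P & f \notin S.
  by apply/subsetPn; apply: contra nS => PS; apply: linkedS lP.
have fF' := subsetP PF f fP.
exists f; first by rewrite inE fS.
have nP : ~~ linked (P :\ f) x y.
  apply/negP => lPf; have : P :\ f = P.
    by apply: mP; rewrite ?subsetDl // (subset_trans (subsetDl _ _) PF).
  by move=> eP; move: fP; rewrite -eP !inE eqxx.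
apply: contra (forall_inP fF f fF') => lFf.
have sPF : P :\ f \subset F :\ f := setSD _ PF.
case/or3P: (linkedD1 fP lP) => [|/andP[/(linkedS sPF) h1 /(linkedS sPF) h2]|
  /andP[/(linkedS sPF) h1 /(linkedS sPF) h2]]; first by rewrite (negPf nP).
  rewrite linkedC in h1; apply: linked_trans (linked_trans h1 lFf) _.
  by rewrite linkedC.
rewrite linkedC in lFf; apply: linked_trans h2 (linked_trans lFf h1).
Qed.

(** Exchange: [e] may replace an edge [f] that separates the ends of [e]. *)
Lemma links_exchange F W e f : links F W -> f \in F ->
  linked F (s e) (t e) -> ~~ linked (F :\ f) (s e) (t e) ->
  links (e |: F :\ f) W.
Proof.
move=> /linksP lF fF le ne; apply/linksP => x y xW yW.
apply: linked_subrel (lF x y xW yW) => g gF.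
have [->|gf] := eqVneq g f; last by apply: linked_edge; rewrite !inE gf gF orbT.
have sub : F :\ f \subset e |: F :\ f by rewrite subsetUr.
have ee : linked (e |: F :\ f) (s e) (t e) by rewrite linked_edge // !inE eqxx.
case/or3P: (linkedD1 fF le) => [|/andP[/(linkedS sub) h1 /(linkedS sub) h2]|
  /andP[/(linkedS sub) h1 /(linkedS sub) h2]]; first by rewrite (negPf ne).
  by rewrite linkedC in h1; apply: linked_trans h1 (linked_trans ee _); rewrite linkedC.
by apply: linked_trans h2 (linked_trans _ h1); rewrite linkedC.
Qed.

End EdgeSets.

(** * Spanning trees *)

Section Trees.
Variables (V E : finType).
Implicit Types (K : mgraph V E) (F g : {set E}).

(** The first edge of a cycle is bypassed by the other ones. *)
Lemma cycle_not_forest K c :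
  is_cycle K c -> ~~ forest (src K) (tgt K) (edges K).
Proof.
case: c => [|[v e] c]; first by [].
case/and5P=> _ _ /andP[eNc _] /andP[eE cE] /= pth.
apply/negP => /forall_inP/(_ e eE)/negP; apply.
suff h x f d : joins K f x (head (v, e) d).1 -> e \notin unzip2 d ->
    all (fun e => e \in edges K) (unzip2 d) ->
    path (fun p q => joins K p.2 p.1 q.1) (x, f) (rcons d (v, e)) ->
    linked (src K) (tgt K) (edges K :\ e) (head (v, e) d).1 v.
  have j : joins K e v (head (v, e) c).1 by case: c {eNc cE} pth => [|? ?] /andP[].
  have := h v e c j eNc cE pth.
  move: j; rewrite /joins => /orP[]/andP[/eqP -> /eqP ->] //.
  by rewrite linkedC.
elim: d x f => [|[y f'] d IH] x f /=; first by move=> *; apply: linked_refl.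
rewrite inE negb_or => j /andP[ef eNd] /andP[f'E dE] /andP[_ pd].
have j' : joins K f' y (head (v, e) d).1 by case: d {IH eNd dE} pd => [|? ?] /andP[].
apply: linked_trans (IH y f' j' eNd dE pd).
apply: connect1; apply/existsP; exists f'.
by rewrite !inE eq_sym ef f'E.
Qed.

(** A simple path [x :: p] is extended by an edge [e] at its end; together
    with the names of its edges, it forms the vertex-edge sequence of a
    potential cycle. *)
Lemma path_edge_names K F e x p :
  path (link (src K) (tgt K) F) x p -> uniq (x :: p) -> e \notin F ->
  exists e0 d, [/\ unzip1 ((x, e0) :: d) = x :: p,
    uniq (unzip2 ((x, e0) :: d)),
    {subset unzip2 ((x, e0) :: d) <= e |: F},
    forall f, f \in unzip2 ((x, e0) :: d) -> f != e ->
      (src K f \in x :: p) && (tgt K f \in x :: p)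
    & forall z : V * E, joins K e (last x p) z.1 ->
      path (fun p q => joins K p.2 p.1 q.1) (x, e0) (rcons d z)].
Proof.
move=> + + eF; elim: p x => [|y p IH] x.
  move=> _ _; exists e, [::]; split=> //= [f|f|z ->] //.
    by rewrite !inE => ->.
  by rewrite inE => /eqP->; rewrite eqxx.
move=> /= /andP[/exists_inP[e1 e1F j1]] /IH + /andP[xp up].
case=> // e0 [d [ud1 ud2 dF dp pth]]; exists e1, ((y, e0) :: d).
have xNe1 : (src K e1 == x) || (tgt K e1 == x).
  by case/orP: j1 => /andP[h1 h2]; rewrite ?h1 ?h2 ?orbT.
have e1e : e1 != e by apply: contraNneq eF => <-.
split.
- by move: ud1 => /= ->.
- rewrite /= in ud2 *; rewrite ud2 andbT; apply/negP => e1d.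
  have /andP[h1 h2] := dp e1 e1d e1e.
  by case/orP: xNe1 => /eqP xe; rewrite xe ?h1 ?h2 (negPf xp) in h1 h2.
- move=> f; rewrite inE => /orP[/eqP->|]; last exact: dF.
  by rewrite !inE e1F orbT.
- move=> f; rewrite inE => /orP[/eqP-> _|fd fe].
    by case/orP: j1 => /andP[/eqP-> /eqP->]; rewrite !inE !eqxx ?orbT.
  by have /andP[h1 h2] := dp f fd fe; rewrite inE h1 orbT inE h2 orbT.
by move=> z jz; rewrite /= in pth *; rewrite pth // andbT.
Qed.

Lemma not_forest_cycle K :
  ~~ forest (src K) (tgt K) (edges K) -> exists c, is_cycle K c.
Proof.
case/forall_inPn=> e eE /negPn/connectP[p /shortenP[p' pp' up' _] lp].
have eN : e \notin edges K :\ e by rewrite !inE eqxx.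
have [e0 [d [d1 d2 dE _ dpth]]] := path_edge_names pp' up' eN.
exists ((src K e, e0) :: d); apply/and5P; split=> //.
- by rewrite d1.
- by apply/allP => f /dE; rewrite setD1K.
- by apply: dpth; rewrite -lp /joins !eqxx orbT.
Qed.

Lemma is_treeP K :
  is_tree K <-> connected K /\ forest (src K) (tgt K) (edges K).
Proof.
split=> -[cK h]; split=> //.
  apply: contraT => /not_forest_cycle[c]; by rewrite (negPf (h c)).
by move=> c; apply: contraL h => /cycle_not_forest.
Qed.

Lemma connectedE K : connected K =
  (verts K != set0) && links (src K) (tgt K) (edges K) (verts K).
Proof. by []. Qed.

Lemma inside_edges K F : F \subset edges K -> inside (src K) (tgt K) F (verts K).
Proof. by move=> /subsetP sF; apply/insideP => e /sF/endsP/andP[]. Qed.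

(** Spanning trees as connected forests, without reference to cycles. *)
Lemma spanning_treesP K g : reflect
  [/\ g \subset edges K, verts K != set0, links (src K) (tgt K) g (verts K)
    & forest (src K) (tgt K) g] (g \in spanning_trees K).
Proof.
rewrite inE; apply: (iffP (asboolP _)) => [[gK /is_treeP[]]|[gK V0 lg fg]].
  by rewrite connectedE /= (setIidPl gK) => /andP[V0 lg] fg.
by split=> //; apply/is_treeP; rewrite connectedE /= (setIidPl gK) V0.
Qed.

Lemma spanning_tree_card K g : g \in spanning_trees K -> #|g|.+1 = #|verts K|.
Proof.
case/spanning_treesP => gK V0 lg fg.
exact: forest_links_card V0 (inside_edges gK) fg lg.
Qed.

Lemma links_spanning_tree K g : g \subset edges K -> #|g|.+1 = #|verts K| ->
  links (src K) (tgt K) g (verts K) -> g \in spanning_trees K.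
Proof.
move=> gK cg lg; apply/spanning_treesP; split=> //.
  by rewrite -card_gt0 -cg.
exact: links_card_forest (inside_edges gK) lg cg.
Qed.

Lemma forest_spanning_tree K g : g \subset edges K -> #|g|.+1 = #|verts K| ->
  forest (src K) (tgt K) g -> g \in spanning_trees K.
Proof.
move=> gK cg fg; apply: links_spanning_tree => //.
exact: forest_card_links (inside_edges gK) fg cg.
Qed.

Lemma spanning_tree_exchange K g e f : g \in spanning_trees K ->
  e \in edges K -> f \in g -> ~~ linked (src K) (tgt K) (g :\ f) (src K e) (tgt K e) ->
  e |: g :\ f \in spanning_trees K.
Proof.
move=> gT eK fg ne; have [gK V0 lg frg] := spanning_treesP _ _ gT.
have /andP[se te] := endsP eK.
have [ef|ef] := eqVneq e f; first by rewrite ef setD1K.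
have eg : e \notin g :\ f by apply: contra ne; apply: linked_edge.
apply: links_spanning_tree.
- by rewrite subUset sub1set eK (subset_trans (subsetDl _ _) gK).
- by rewrite cardsU1 eg add1n -(spanning_tree_card gT) (cardsD1 f g) fg.
apply: links_exchange => //.
exact: (linksP _ _ _ _ lg).
Qed.

(** The restriction of a spanning tree to [F] is a forest on the ends of the
    edges in [F]. *)
Lemma spanning_tree_restr K g F : g \in spanning_trees K ->
  F \subset edges K -> F != set0 -> (#|g :&: F| < #|verts (esub K F)|)%N.
Proof.
move=> /spanning_treesP[gK V0 lg fg] FK /set0Pn[e eF].
apply: (@ltn_card_forest _ _ (src K) (tgt K)); last exact: forestS (subsetIl _ _) fg.
  by apply/set0Pn; exists (src K e); rewrite /= (setIidPl FK) inE imset_f.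
apply: insideS (subsetIr g F) _.
apply/insideP => f fF; have fI : f \in F :&: edges K by rewrite inE fF (subsetP FK).
by have /andP[] := @endsP _ _ (esub K F) f fI.
Qed.

End Trees.

(** * Spanning trees of a shrunk graph *)

Section Shrink.
Variables (V E : finType) (G : mgraph V E) (H : {set E}).
Implicit Types (g : {set E}) (e : E) (x y : V).
Hypotheses (HG : H \subset edges G) (H0 : H != set0).

Notation col := (collapse G H).
Notation VH := (verts (esub G H)).

Lemma edges_esub : edges (esub G H) = H.
Proof. exact: (setIidPl HG). Qed.

Lemma verts_esub_sub : VH \subset verts G.
Proof.
apply/subsetP => x; rewrite inE => /orP[]/imsetP[e]; rewrite inE => /andP[_ /endsP].
  by case/andP=> ? _ ->.
by case/andP=> _ ? ->.
Qed.

Lemma mem_verts_esub e : e \in H -> (src G e \in VH) && (tgt G e \in VH).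
Proof. by move=> eH; apply: (@endsP _ _ (esub G H)); rewrite edges_esub. Qed.

Lemma verts_esub_neq0 : VH != set0.
Proof.
case/set0Pn: H0 => e /mem_verts_esub/andP[h _].
by apply/set0Pn; exists (src G e).
Qed.

Lemma collapse_eq x y : (col x == col y) = (x == y) || (x \in VH) && (y \in VH).
Proof.
rewrite /collapse; case: ifP => xH; case: ifP => yH; rewrite ?orbT ?orbF //=.
by apply/esym/negP => /eqP xy; rewrite xy yH in xH.
by apply/esym/negP => /eqP xy; rewrite xy yH in xH.
Qed.

Lemma card_verts_shrink : (#|verts (shrink G H)| + #|VH| = #|verts G|.+1)%N.
Proof.
have -> : verts (shrink G H) = None |: (Some @: (verts G :\: VH)).
  apply/setP => -[x|].
    rewrite !inE /=; apply/imsetP/imsetP => -[y yG].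
      by rewrite /collapse; case: ifP => // yH [->]; exists y; rewrite // in_setD yH.
    by move: yG; rewrite in_setD => /andP[/negPf yH yG] [->]; exists y; rewrite // /collapse yH.
  rewrite !inE eqxx /=; case/set0Pn: verts_esub_neq0 => x xH.
  apply/imsetP; exists x; first exact: (subsetP verts_esub_sub).
  by rewrite /collapse xH.
rewrite cardsU1 card_imset; last by move=> ? ? [].
have -> : None \notin (Some @: (verts G :\: VH)) by apply/imsetP => -[].
rewrite -(cardsID VH (verts G)) (setIidPr verts_esub_sub) add1n addSn.
by rewrite addnC.
Qed.

(** Given a spanning tree [g1] of [H], the sets [g2] and [g] have together the
    size of a spanning tree, of the shrunk graph and of [G] respectively. *)
Lemma card_shrink_tree (g1 g2 g : {set E}) : g1 \in spanning_trees (esub G H) ->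
  (#|g1| + #|g2| = #|g|)%N ->
  (#|g2|.+1 == #|verts (shrink G H)|) = (#|g|.+1 == #|verts G|).
Proof.
move=> /spanning_tree_card c1 c; rewrite -(eqn_add2r #|VH|) card_verts_shrink.
by rewrite -c1 addnS eqSS addSn -c (addnC #|g1|).
Qed.

Lemma spanning_tree_shrink g : g \in spanning_trees G ->
  g :&: H \in spanning_trees (esub G H) ->
  g :\: H \in spanning_trees (shrink G H).
Proof.
move=> gT gH; have [gG V0 lg fg] := spanning_treesP _ _ gT.
have [_ _ lH _] := spanning_treesP _ _ gH.
apply: links_spanning_tree.
- apply/subsetP => e; rewrite in_setD => /andP[eH eg].
  rewrite inE (subsetP gG) //= collapse_eq negb_or.
  (* otherwise [g :&: H] would already link the ends of [e] *)
  have nl : ~~ linked (src G) (tgt G) (g :&: H) (src G e) (tgt G e).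
    apply: contra (forall_inP fg e eg); apply: linkedS.
    by apply/subsetP => f; rewrite !inE => /andP[-> fH]; rewrite (memPn eH).
  apply/andP; split.
    by apply: contraNneq nl => ->; apply: linked_refl.
  by apply: contra nl => /andP[sH tH]; apply: (linksP _ _ _ _ lH).
- apply/eqP; rewrite (card_shrink_tree gH (cardsID H g)).
  exact/eqP/spanning_tree_card.
apply/linksP => _ _ /imsetP[x xG ->] /imsetP[y yG ->].
apply: (@linked_ind _ _ (src G) (tgt G) g (fun z =>
  linked (src (shrink G H)) (tgt (shrink G H)) (g :\: H) (col x) (col z)) x);
  [|exact: linked_refl|exact: (linksP _ _ _ _ lg)].
move=> e eg; case eH : (e \in H).
  have /andP[sH tH] := mem_verts_esub eH.
  by rewrite /collapse sH tH.
have eD : e \in g :\: H by rewrite inE eH.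
by rewrite -[col (src G e)]/(src (shrink G H) e) (linked_edge_r _ _ _ eD).
Qed.

Lemma shrink_tree_disjoint g : g \in spanning_trees (shrink G H) ->
  [disjoint g & H].
Proof.
case/spanning_treesP=> gS _ _ _; rewrite disjoint_subset.
apply/subsetP => e /(subsetP gS); rewrite !inE => /andP[_]; apply: contra.
by rewrite collapse_eq => /mem_verts_esub ->; rewrite orbT.
Qed.

Lemma core_tree_sub g : g \in spanning_trees (esub G H) -> g \subset H.
Proof. by case/spanning_treesP; rewrite edges_esub. Qed.

Section Union.
Variables g1 g2 : {set E}.
Hypotheses (g1T : g1 \in spanning_trees (esub G H))
  (g2T : g2 \in spanning_trees (shrink G H)).

Lemma union_tree_setI : (g1 :|: g2) :&: H = g1.
Proof.
rewrite setIUl (setIidPl (core_tree_sub g1T)).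
by rewrite (disjoint_setI0 (shrink_tree_disjoint g2T)) setU0.
Qed.

Lemma union_tree_setD : (g1 :|: g2) :\: H = g2.
Proof.
rewrite setDUl (_ : g1 :\: H = set0) ?set0U; last first.
  by apply/eqP; rewrite setD_eq0 core_tree_sub.
exact/setDidPl/shrink_tree_disjoint.
Qed.

Lemma union_spanning_tree : g1 :|: g2 \in spanning_trees G.
Proof.
have [g1E V0 l1 _] := spanning_treesP _ _ g1T.
have [g2E _ l2 _] := spanning_treesP _ _ g2T.
rewrite edges_esub in g1E.
apply: links_spanning_tree.
- rewrite subUset (subset_trans g1E HG) (subset_trans g2E) //.
  by apply/subsetP => e; rewrite inE => /andP[].
- apply/eqP; rewrite -(card_shrink_tree (g2 := g2) g1T).
    exact/eqP/spanning_tree_card.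
  by rewrite -(cardsID H (g1 :|: g2)) union_tree_setI union_tree_setD.
have lU x y : col x == col y -> linked (src G) (tgt G) (g1 :|: g2) x y.
  rewrite collapse_eq => /orP[/eqP->|/andP[xH yH]]; first exact: linked_refl.
  exact: linkedS (subsetUl _ _) (linksP _ _ _ _ l1 _ _ xH yH).
apply/linksP => x y xG yG.
have lxy := linksP _ _ _ _ l2 _ _ (imset_f col xG) (imset_f col yG).
suff : forall z, col z = col y -> linked (src G) (tgt G) (g1 :|: g2) x z by apply.
apply: (@linked_ind _ _ (src (shrink G H)) (tgt (shrink G H)) g2 (fun a =>
  forall z, col z = a -> linked (src G) (tgt G) (g1 :|: g2) x z)) lxy; last first.
  by move=> z xz; apply: lU; rewrite xz.
move=> e eg2; have eU : e \in g1 :|: g2 by rewrite inE eg2 orbT.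
split=> h z /= ez.
  by apply: (linked_trans (y := tgt G e)); rewrite -?(linked_edge_r _ _ _ eU) ?h ?lU ?ez.
by apply: (linked_trans (y := src G e)); rewrite ?(linked_edge_r _ _ _ eU) ?h ?lU ?ez.
Qed.

End Union.
End Shrink.

Local Open Scope ring_scope.

(** * Edge usage and optimality *)

Section Usage.
Variables (R : realType) (V E : finType) (K : mgraph V E).
Implicit Types (mu nu : {set E} -> R) (F g : {set E}) (e f : E).

(** The probability that a random tree with law [mu] contains [e]. *)
Definition usage mu e : R := \sum_(g in spanning_trees K) mu g * (e \in g)%:R.

Lemma card_setI_sum F g : #|g :&: F|%:R = \sum_(e in F) (e \in g)%:R :> R.
Proof.
rewrite -sum1_card natr_sum big_mkcond [RHS]big_mkcond /=.
by apply: eq_bigr => e _; rewrite inE; case: (e \in g); case: (e \in F).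
Qed.

Lemma expected_overlapE mu : expected_overlap K mu = \sum_e usage mu e ^+ 2.
Proof.
under [RHS]eq_bigr => e _ do rewrite expr2 /usage mulr_suml.
rewrite exchange_big /=; apply: eq_bigr => g gT.
under [RHS]eq_bigr => e _ do rewrite mulr_sumr.
rewrite exchange_big /=; apply: eq_bigr => g' g'T.
rewrite setIC card_setI_sum mulr_sumr big_mkcond /=; apply: eq_bigr => e _.
by case: (e \in g); rewrite ?mulr0 ?mul0r ?mulr1 //; rewrite mulrA.
Qed.

Lemma sum_usage mu F : \sum_(e in F) usage mu e =
  \sum_(g in spanning_trees K) mu g * #|g :&: F|%:R.
Proof.
rewrite exchange_big /=; apply: eq_bigr => g _.
by rewrite card_setI_sum mulr_sumr.
Qed.

(** If all the trees of the support have [n] edges in [F], then the total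
    usage of [F] is [n]. *)
Lemma sum_usage_const mu F n : tree_pmf K mu ->
  (forall g, g \in spanning_trees K -> 0 < mu g -> #|g :&: F| = n) ->
  \sum_(e in F) usage mu e = n%:R.
Proof.
case=> mu0 mu1 h; rewrite sum_usage -[RHS]mul1r -mu1 mulr_suml.
apply: eq_bigr => g gT; have := mu0 g gT; rewrite le_eqVlt.
by case/orP=> [/eqP<-|/h->//]; rewrite ?mul0r.
Qed.

(** First-order optimality: for the usage as edge weight, every tree of the
    support has minimal weight. *)
Lemma meo_min_weight mu g g' : meo_optimal K mu ->
  g \in spanning_trees K -> 0 < mu g -> g' \in spanning_trees K ->
  \sum_(e in g) usage mu e <= \sum_(e in g') usage mu e.
Proof.
move=> [[mu0 mu1] opt] gT mug g'T; rewrite leNgt; apply/negP => lt.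
have [eg|ng] := eqVneq g g'; first by rewrite eg ltxx in lt.
pose d e : R := (e \in g')%:R - (e \in g)%:R.
pose S := \sum_e usage mu e * d e; pose Q := \sum_e d e ^+ 2.
have S0 : S < 0.
  suff -> : S = \sum_(e in g') usage mu e - \sum_(e in g) usage mu e by rewrite subr_lt0.
  rewrite [X in X - _]big_mkcond [X in _ - X]big_mkcond -sumrB; apply: eq_bigr => e _.
  by rewrite /d; case: (e \in g'); case: (e \in g) => /=; ring.
have Q0 : 0 <= Q by apply: sumr_ge0 => e _; apply: sqr_ge0.
(* a small mass [eps] is moved from [g] to [g'] *)
pose eps := Num.min (mu g) (- S / (Q + 1)).
have eps0 : 0 < eps by rewrite lt_min mug divr_gt0 //; lra.
have epsg : eps <= mu g by rewrite ge_min lexx.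
have epsQ : eps * (Q + 1) <= - S.
  by rewrite -ler_pdivlMr ?ge_min ?lexx ?orbT //; lra.
pose nu h := mu h + eps * ((h == g')%:R - (h == g)%:R).
have sum_ind (k : {set E}) (c : {set E} -> R) : k \in spanning_trees K ->
    \sum_(h in spanning_trees K) (h == k)%:R * c h = c k.
  move=> kT; rewrite (bigD1 k) //= eqxx mul1r big1 ?addr0 // => h /andP[_ /negPf->].
  by rewrite mul0r.
have lin (c : {set E} -> R) : \sum_(h in spanning_trees K) nu h * c h =
    \sum_(h in spanning_trees K) mu h * c h + eps * (c g' - c g).
  rewrite -(sum_ind g' c g'T) -(sum_ind g c gT) -sumrB mulr_sumr -big_split /=.
  by apply: eq_bigr => h _; rewrite /nu; ring.
have usnu e : usage nu e = usage mu e + eps * d e by rewrite /usage lin.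
have pnu : tree_pmf K nu.
  split=> [h hT|].
    rewrite /nu; have := mu0 h hT; have [->|] := eqVneq h g.
      by rewrite (negPf ng) /= => _; lra.
    by case: (h == g') => /= _; lra.
  by have := lin (fun=> 1); under eq_bigr do rewrite mulr1;
     under [X in _ = X + _]eq_bigr do rewrite mulr1; rewrite mu1 => ->; ring.
have := opt nu pnu; rewrite !expected_overlapE; apply/negP; rewrite -ltNge.
have -> : \sum_e usage nu e ^+ 2 =
    \sum_e usage mu e ^+ 2 + eps * (2 * S + eps * Q).
  rewrite /S /Q !mulr_sumr -big_split /= mulr_sumr -big_split /=.
  by apply: eq_bigr => e _; rewrite usnu; ring.
rewrite gtrDl pmulr_rlt0 //; lra.
Qed.

Lemma meo_exchange mu g e f : meo_optimal K mu ->
  g \in spanning_trees K -> 0 < mu g -> e \in edges K -> f \in g ->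
  ~~ linked (src K) (tgt K) (g :\ f) (src K e) (tgt K e) ->
  usage mu f <= usage mu e.
Proof.
move=> opt gT mug eK fg nl.
have := meo_min_weight opt gT mug (spanning_tree_exchange gT eK fg nl).
rewrite (big_setD1 f) //= big_setU1 /= ?lerD2r //.
by apply: contra nl; apply: linked_edge.
Qed.

(** Let [C] be the component of [e0] in the set of the edges of minimal usage
    [m].  Every tree of the support spans [C]. *)
Lemma min_usage_component mu e0 : meo_optimal K mu -> e0 \in edges K ->
  (forall e, e \in edges K -> usage mu e0 <= usage mu e) ->
  exists C : {set E}, [/\ C \in conn_subs K,
    forall e, e \in C -> usage mu e = usage mu e0
    & forall g, g \in spanning_trees K -> 0 < mu g ->
        #|g :&: C|.+1 = #|verts (esub K C)|].
Proof.
move=> opt e0K minm; set m := usage mu e0.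
pose F := [set e in edges K | usage mu e == m].
pose A := [set x | linked (src K) (tgt K) F (src K e0) x].
have clA e : e \in F -> (src K e \in A) = (tgt K e \in A).
  by move=> eF; rewrite !inE (linked_edge_r _ _ _ eF).
have FK : F \subset edges K by apply/subsetP => e; rewrite inE => /andP[].
pose C := [set e in F | src K e \in A].
have CF : C \subset F by apply/subsetP => e; rewrite inE => /andP[].
have CK := subset_trans CF FK.
have e0C : e0 \in C by rewrite !inE e0K eqxx linked_refl.
have C0 : C != set0 by apply/set0Pn; exists e0.
have VA x : x \in verts (esub K C) -> x \in A.
  rewrite /= (setIidPl CK) inE => /orP[]/imsetP[e]; rewrite inE => /andP[eF eA] -> //.
  by rewrite -clA.
have lC x y : x \in verts (esub K C) -> y \in verts (esub K C) ->
    linked (src K) (tgt K) C x y.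
  move=> /VA xA /VA yA; apply: (linked_restrict clA xA).
  by rewrite !inE in xA yA; apply: linked_trans yA; rewrite linkedC.
exists C; split.
- rewrite inE CK card_gt0 C0 connectedE verts_esub_neq0 // (edges_esub CK).
  by apply/linksP; apply: lC.
- by move=> e /(subsetP CF); rewrite inE => /andP[_ /eqP].
move=> g gT mug; have [gK V0 lg fg] := spanning_treesP _ _ gT.
have iC : inside (src K) (tgt K) C (verts (esub K C)).
  by apply/insideP => e eC; have /andP[] := mem_verts_esub CK eC.
apply: forest_links_card.
- exact: verts_esub_neq0.
- exact: insideS (subsetIr g C) iC.
- exact: forestS (subsetIl _ _) fg.
apply/linksP => x y xC yC; apply: linked_subrel (lC x y xC yC) => e.
rewrite inE => /andP[eF eA].
have lgF : linked (src K) (tgt K) (g :&: F) (src K e) (tgt K e).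
  apply: contraT => nl; have eK := subsetP FK e eF.
  have le : linked (src K) (tgt K) g (src K e) (tgt K e).
    by have /andP[? ?] := endsP eK; apply: (linksP _ _ _ _ lg).
  have [f] := forest_separating_edge fg le nl.
  rewrite !inE => /andP[]; case fg' : (f \in g) => //= fF _ nlf.
  have := meo_exchange opt gT mug eK fg' nlf.
  move: eF fF; rewrite inE => /andP[_ /eqP ->]; rewrite (subsetP gK) //=.
  by rewrite eq_le (minm f) ?andbT ?(subsetP gK) // => /negPf->.
have := @linked_restrict _ _ (src K) (tgt K) (g :&: F) A (src K e) (tgt K e).
have -> : [set e1 in g :&: F | src K e1 \in A] = g :&: C.
  by rewrite /C !setIdE setIA.
apply => // f; rewrite inE => /andP[_]; exact: clA.
Qed.

End Usage.

(** * Existence of an optimal law *)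

Section Existence.
Import numFieldNormedType.Exports.

(** The values of a law are read off a point of the unit cube; those outside
    the spanning trees are irrelevant, and are taken to be zero in [tov]. *)
Lemma meo_optimal_exists (R : realType) (V E : finType) (K : mgraph V E)
    (mu0 : {set E} -> R) :
  tree_pmf K mu0 -> exists mu : {set E} -> R, meo_optimal K mu.
Proof.
move=> pmu0; pose ev (v : 'rV[R]_#|{set E}|) (g : {set E}) : R := v ord0 (enum_rank g).
pose A : set 'rV[R]_#|{set E}| :=
  ([set v : 'rV[R]_#|{set E}| | forall i, `[0, 1] (v ord0 i)] `&`
   [set v | \sum_(g in spanning_trees K) ev v g = 1])%classic.
have cev g : continuous (ev^~ g) by move=> v; apply: coord_continuous.
have csum : continuous (fun v => \sum_(g in spanning_trees K) ev v g).
  by apply: (continuous_big (@add_continuous R)) => g _; exact: cev.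
have cA : compact A.
  apply: compact_closedI.
    apply: (@rV_compact R _ (fun=> `[0, 1]%classic)) => i.
    exact: segment_compact.
  apply: (@preimage_closed _ _ (fun v => \sum_(g in spanning_trees K) ev v g)
    [set x : R | x = 1]%classic) (@closed_eq R 1).
  by move=> v _; apply: csum.
have cf : continuous (fun v => expected_overlap K (ev v)).
  apply: (continuous_big (@add_continuous R)) => g _.
  apply: (continuous_big (@add_continuous R)) => g' _ v.
  apply: (@continuousM R _ (fun x => ev x g * ev x g') (fun=> #|g :&: g'|%:R) v).
    by apply: (@continuousM R _ (ev^~ g) (ev^~ g') v); apply: cev.
  exact: cst_continuous.
pose tov (nu : {set E} -> R) : 'rV[R]_#|{set E}| :=
  \row_i (if enum_val i \in spanning_trees K then nu (enum_val i) else 0).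
have evK nu g : g \in spanning_trees K -> ev (tov nu) g = nu g.
  by move=> gT; rewrite /ev mxE enum_rankK gT.
have Atov nu : tree_pmf K nu -> A (tov nu).
  case=> nu0 nu1; split; last first.
    by apply: etrans nu1; apply: eq_bigr => g gT; exact: evK.
  move=> i; rewrite /= mxE; case: ifP => iT; rewrite in_itv /= ?lexx ?ler01 //.
  rewrite nu0 //= -nu1 (bigD1 (enum_val i)) //= lerDl.
  by apply: sumr_ge0 => g /andP[gT _]; apply: nu0.
have [v Av vmin] := @compact_EVT_min _ R (fun v => expected_overlap K (ev v)) A
  (ex_intro _ _ (Atov _ pmu0)) cA (continuous_subspaceT cf).
have [v01 v1] := set_mem Av; exists (ev v); split.
  split=> // g gT.
  by have := v01 (enum_rank g); rewrite /= in_itv /= => /andP[].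
move=> nu pnu; have := vmin (tov nu) (mem_set (Atov _ pnu)).
congr (_ <= _); apply: eq_bigr => g gT; apply: eq_bigr => g' g'T.
by rewrite !evK.
Qed.

End Existence.

(** * Densest subgraphs *)

Section Core.
Variables (V E : finType) (G : mgraph V E).
Hypothesis hloop : loopless G.
Implicit Types (C F H g : {set E}).

Lemma conn_subsP F : reflect
  [/\ F \subset edges G, F != set0 & connected (esub G F)] (F \in conn_subs G).
Proof. by rewrite inE card_gt0; apply: and3P. Qed.

Lemma card_verts_esub_gt1 F : F \subset edges G -> F != set0 ->
  (1 < #|verts (esub G F)|)%N.
Proof.
move=> FG /set0Pn[e eF]; have eG := subsetP FG e eF.
have /andP[sF tF] := mem_verts_esub FG eF.
rewrite (cardsD1 (src G e)) sF ltnS card_gt0.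
apply/set0Pn; exists (tgt G e); rewrite in_setD1 tF andbT eq_sym.
exact: (forall_inP hloop).
Qed.

Lemma density_esub F : F \subset edges G -> F != set0 ->
  density (esub G F) = #|F|%:R / #|verts (esub G F)|.-1%:R.
Proof.
move=> FG F0; rewrite /density (edges_esub FG); congr (_ / _).
by rewrite -[in LHS](prednK (ltnW (card_verts_esub_gt1 FG F0))) -natr1 addrK.
Qed.

Lemma density_esub_le C H : C \in conn_subs G -> H \in conn_subs G ->
  (density (esub G C) <= density (esub G H)) =
  (#|C| * #|verts (esub G H)|.-1 <= #|H| * #|verts (esub G C)|.-1)%N.
Proof.
move=> /conn_subsP[CG C0 _] /conn_subsP[HG H0 _].
have gt0 F : F \subset edges G -> F != set0 ->
    0 < #|verts (esub G F)|.-1%:R :> rat.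
  by move=> FG F0; rewrite ltr0n -subn1 subn_gt0 card_verts_esub_gt1.
rewrite !density_esub // ler_pdivrMr ?gt0 // mulrAC ler_pdivlMr ?gt0 //.
by rewrite -!natrM ler_nat.
Qed.

(** The trees in the support of an optimal law span every densest connected
    subgraph [H].  Indeed the least usage [m] is at least the inverse of the
    density of [H], by [min_usage_component], so the expected number of edges
    of [H] in a random tree is at least [#|V_H| - 1], which is also the largest
    possible number. *)
Lemma support_spans_densest (R : realType) (mu : {set E} -> R) H g :
  meo_optimal G mu -> H \in conn_subs G ->
  (forall F, F \in conn_subs G -> density (esub G F) <= density (esub G H)) ->
  g \in spanning_trees G -> 0 < mu g ->
  g :&: H \in spanning_trees (esub G H).
Proof.
move=> opt HS dmax gT mug; have [HG H0 cH] := conn_subsP _ HS.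
have [[mu0 mu1] _] := opt.
have [eH eHH] := set0Pn _ H0; have eHG := subsetP HG eH eHH.
have [e0 e0G minm] : exists2 e0, e0 \in edges G &
    forall e, e \in edges G -> usage G mu e0 <= usage G mu e.
  case: (@Order.TotalTheory.arg_minP _ _ _ eH (mem (edges G)) (usage G mu) eHG) => e0 h1 h2.
  by exists e0.
set m := usage G mu e0 in minm.
have [C [CS Cm Cspan]] := min_usage_component opt e0G minm.
have [CG C0 cC] := conn_subsP _ CS.
set vH := #|verts (esub G H)|; set vC := #|verts (esub G C)|.
have vH1 : (1 < vH)%N := card_verts_esub_gt1 HG H0.
have vC1 : (1 < vC)%N := card_verts_esub_gt1 CG C0.
have mC : m * #|C|%:R = vC.-1%:R.
  rewrite -(@sum_usage_const _ _ _ G mu C vC.-1 (proj1 opt)).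
    by rewrite (eq_bigr (fun=> m)) ?sumr_const ?mulr_natr // => e /Cm.
  by move=> h hT muh; rewrite /vC -(Cspan h hT muh).
have mH : vH.-1%:R <= m * #|H|%:R.
  have C_gt0 : 0 < #|C|%:R :> R by rewrite ltr0n card_gt0.
  rewrite -(ler_pM2r C_gt0) mulrAC mC -!natrM ler_nat mulnC [leqRHS]mulnC.
  by rewrite -density_esub_le ?dmax.
have usH : vH.-1%:R <= \sum_(e in H) usage G mu e.
  apply: le_trans mH _; rewrite mulr_natr -sumr_const ler_sum // => e He.
  exact/minm/(subsetP HG).
have le_tree h : h \in spanning_trees G -> (#|h :&: H| <= vH.-1)%N.
  by move=> hT; rewrite -ltnS prednK ?(ltnW vH1) // spanning_tree_restr.
have cgH : #|g :&: H| = vH.-1.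
  apply/eqP; rewrite eqn_leq le_tree //= leqNgt; apply/negP => lt.
  move: usH; rewrite sum_usage leNgt => /negP; apply.
  rewrite -[ltRHS]mul1r -[X in _ < X * _]mu1 mulr_suml (bigD1 g) //= [ltRHS](bigD1 g) //=.
  rewrite ltr_leD //; first by rewrite ltr_pM2l // ltr_nat.
  apply: ler_sum => h /andP[hT _]; apply: ler_wpM2l; first exact: mu0.
  by rewrite ler_nat le_tree.
apply: forest_spanning_tree.
- by rewrite edges_esub // subsetIr.
- by rewrite cgH prednK // ltnW.
by have [_ _ _ fg] := spanning_treesP _ _ gT; apply: forestS (subsetIl _ _) fg.
Qed.

Lemma full_conn_sub : connected G -> edges G != set0 ->
  density (esub G (edges G)) = density G /\ edges G \in conn_subs G.
Proof.
move=> cG G0.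
have eV : verts (esub G (edges G)) = verts G.
  apply/eqP; rewrite eqEsubset verts_esub_sub //=; apply/subsetP => x xG.
  have [e eG] := set0Pn _ G0; have /andP[sG tG] := endsP eG.
  have /andP[sE tE] := mem_verts_esub (subxx _) eG.
  have [_ /linksP l] := andP (etrans (esym (connectedE G)) cG).
  have := linked_inside _ sE (l _ _ sG xG); apply.
  by apply/insideP => f fG; have /andP[] := mem_verts_esub (subxx _) fG.
split; first by rewrite /density eV edges_esub.
by apply/conn_subsP; rewrite connectedE eV edges_esub.
Qed.

Lemma conn_subs_trans H F :
  H \in conn_subs G -> F \in conn_subs (esub G H) ->
  [/\ F \subset H, F \in conn_subs G &
      density (esub (esub G H) F) = density (esub G F)].
Proof.
move=> /conn_subsP[HG H0 _]; rewrite !inE (edges_esub HG) => /and3P[FH F0 cF].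
have e1 : F :&: (H :&: edges G) = F :&: edges G by rewrite setIA (setIidPl FH).
have e2 : edges (esub (esub G H) F) = edges (esub G F) by rewrite /= e1.
have e3 : verts (esub (esub G H) F) = verts (esub G F) by rewrite /= e1.
split=> //; last by rewrite /density e2 e3.
rewrite F0 (subset_trans FH HG); move: cF.
by rewrite !connectedE e2 e3.
Qed.

(** A densest connected subgraph with the least number of edges is a minimal
    core. *)
Lemma minimal_core_exists : connected G -> edges G != set0 ->
  exists H, minimal_core G H /\ forall F, F \in conn_subs G ->
    density (esub G H) <= density (esub G F) -> (#|H| <= #|F|)%N.
Proof.
move=> cG G0; have [_ GS] := full_conn_sub cG G0.
have [M MS Mmax] : exists2 M, M \in conn_subs G & forall F, F \in conn_subs G ->
    density (esub G F) <= density (esub G M).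
  by case: (@Order.TotalTheory.arg_maxP _ _ _ (edges G) (mem (conn_subs G))
    (fun F => density (esub G F)) GS) => M h1 h2; exists M.
have PM : (M \in conn_subs G) && (density (esub G M) <= density (esub G M)).
  by rewrite MS lexx.
have [H /andP[HS HM] Hmin] := @arg_minnP _ M (fun F => (F \in conn_subs G) &&
  (density (esub G M) <= density (esub G F))) (fun F => #|F|) PM.
have least F : F \in conn_subs G -> density (esub G H) <= density (esub G F) ->
    (#|H| <= #|F|)%N.
  by move=> FS le; apply: Hmin; rewrite FS (le_trans HM le).
exists H; split; last exact: least.
split; first exact: HS.
  by move=> F FS; apply: le_trans (Mmax F FS) HM.
move=> F FS FH; have [sFH FG eq] := conn_subs_trans HS FS.
rewrite eq ltNge; apply/negP => le; apply: FH.
by apply/eqP; rewrite eqEcard sFH; apply: least FG le.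
Qed.

Lemma strictly_dense_or_core : connected G -> edges G != set0 ->
  strictly_dense G \/ exists H, minimal_core G H /\ H \proper edges G.
Proof.
move=> cG G0; have [dG GS] := full_conn_sub cG G0.
have [H [[HS Hmax Hd] least]] := minimal_core_exists cG G0.
have [HG _ _] := conn_subsP _ HS.
have [eH|nH] := eqVneq H (edges G); last first.
  by right; exists H; split; rewrite // properEneq nH.
left; split=> [|F FS nF]; first exact: cG.
rewrite ltNge; apply/negP; rewrite -dG -eH => le; apply: nF.
have [FG _ _] := conn_subsP _ FS.
by apply/eqP; rewrite eqEcard FG -eH; apply: least FS le.
Qed.

Lemma strictly_dense_no_core : edges G != set0 ->
  ~ (strictly_dense G /\ exists H, minimal_core G H /\ H \proper edges G).
Proof.
move=> G0 [[cG sd] [H [[HS Hmax _] Hp]]].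
have [dG GS] := full_conn_sub cG G0.
have := sd H HS; rewrite -dG ltNge Hmax // => h.
by have : false by [apply: h => eH; rewrite eH properxx in Hp].
Qed.

End Core.

(** * Splitting and coupling laws along a subgraph *)

(** The law of [phi g], for a random tree [g] of [K] with law [mu]. *)
Definition image_law (R : realType) (V E : finType) (K : mgraph V E)
    (phi : {set E} -> {set E}) (mu : {set E} -> R) (k : {set E}) : R :=
  \sum_(g in spanning_trees K) (phi g == k)%:R * mu g.

Section ImageLaw.
Variables (R : realType) (V V' E : finType).
Variables (K : mgraph V E) (K' : mgraph V' E).
Variables (phi : {set E} -> {set E}) (mu : {set E} -> R).
Hypotheses (pmu : tree_pmf K mu)
  (phiT : forall g, g \in spanning_trees K -> 0 < mu g ->
     phi g \in spanning_trees K').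

Lemma sum_image_law (c : {set E} -> R) :
  \sum_(k in spanning_trees K') image_law K phi mu k * c k =
  \sum_(g in spanning_trees K) mu g * c (phi g).
Proof.
under eq_bigr => k _ do rewrite mulr_suml.
rewrite exchange_big /=; apply: eq_bigr => g gT.
have := proj1 pmu g gT; rewrite le_eqVlt => /orP[/eqP<-|mug].
  by rewrite mul0r big1 // => k _; rewrite mulr0 mul0r.
rewrite (bigD1 (phi g)) ?phiT //= eqxx mul1r big1 ?addr0 // => k /andP[_].
by rewrite eq_sym => /negPf->; rewrite !mul0r.
Qed.

Lemma image_law_pmf : tree_pmf K' (image_law K phi mu).
Proof.
split=> [k _|].
  by apply: sumr_ge0 => g gT; rewrite mulr_ge0 ?ler0n ?(proj1 pmu).
have := sum_image_law (fun=> 1); under eq_bigr do rewrite mulr1.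
by move=> ->; under eq_bigr do rewrite mulr1; apply: (proj2 pmu).
Qed.

Lemma usage_image_law e : usage K' (image_law K phi mu) e =
  \sum_(g in spanning_trees K) mu g * (e \in phi g)%:R.
Proof. exact: (sum_image_law (fun k => (e \in k)%:R)). Qed.

Lemma image_law_gt0 g : g \in spanning_trees K -> 0 < mu g ->
  0 < image_law K phi mu (phi g).
Proof.
move=> gT mug; rewrite /image_law (bigD1 g) //= eqxx mul1r ltr_wpDr //.
by apply: sumr_ge0 => h /andP[hT _]; rewrite mulr_ge0 ?ler0n ?(proj1 pmu).
Qed.

End ImageLaw.

Section Coupling.
Variables (R : realType) (V E : finType) (G : mgraph V E) (H : {set E}).
Hypotheses (HG : H \subset edges G) (H0 : H != set0).
Implicit Types (mu nu : {set E} -> R).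

Notation core := (esub G H).
Notation shr := (shrink G H).

Lemma usage_out (V' : finType) (K : mgraph V' E) mu e :
  e \notin edges K -> usage K mu e = 0.
Proof.
move=> eK; apply: big1 => g /spanning_treesP[/subsetP gK _ _ _].
by rewrite (contraNF (gK e) eK) mulr0.
Qed.

Lemma notin_shrink e : e \in H -> e \notin edges shr.
Proof.
move=> eH; rewrite inE collapse_eq; have /andP[-> ->] := mem_verts_esub HG eH.
by rewrite orbT andbF.
Qed.

(** If the usage of [mu] agrees with that of [mu1] on [H] and with that of
    [mu2] elsewhere, then the expected overlaps add up. *)
Lemma expected_overlap_split mu mu1 mu2 :
  (forall e, e \in H -> usage G mu e = usage core mu1 e) ->
  (forall e, e \notin H -> usage G mu e = usage shr mu2 e) ->
  expected_overlap G mu = expected_overlap core mu1 + expected_overlap shr mu2.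
Proof.
move=> h1 h2; rewrite !expected_overlapE (bigID (mem H)) /=; congr (_ + _).
  rewrite [RHS](bigID (mem H)) /= [X in _ = _ + X]big1 ?addr0 => [|e eH].
    by apply: eq_bigr => e eH; rewrite h1.
  by rewrite usage_out ?expr0n // edges_esub.
rewrite [RHS](bigID (mem H)) /= [X in _ = X + _]big1 ?add0r => [|e eH].
  by apply: eq_bigr => e eH; rewrite h2.
by rewrite usage_out ?expr0n // notin_shrink.
Qed.

Section Split.
Variable mu : {set E} -> R.
Hypotheses (pmu : tree_pmf G mu)
  (span : forall g, g \in spanning_trees G -> 0 < mu g ->
     g :&: H \in spanning_trees core).

(** The laws of the two parts of a random tree of [G]: its restriction to [H]
    and its projection onto the shrunk graph. *)
Definition core_law := image_law G (fun g => g :&: H) mu.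
Definition shrink_law := image_law G (fun g => g :\: H) mu.

Lemma span_shrink g : g \in spanning_trees G -> 0 < mu g ->
  g :\: H \in spanning_trees shr.
Proof. by move=> gT mug; apply: spanning_tree_shrink => //; apply: span. Qed.

Lemma core_law_pmf : tree_pmf core core_law.
Proof. exact: image_law_pmf span. Qed.

Lemma shrink_law_pmf : tree_pmf shr shrink_law.
Proof. exact: image_law_pmf span_shrink. Qed.

Lemma overlap_split : expected_overlap G mu =
  expected_overlap core core_law + expected_overlap shr shrink_law.
Proof.
apply: expected_overlap_split => e eH.
  rewrite (usage_image_law pmu span); apply: eq_bigr => g _.
  by rewrite inE eH andbT.
rewrite (usage_image_law pmu span_shrink); apply: eq_bigr => g _.
by rewrite inE eH.
Qed.

End Split.

(** The law of the union of independent random trees of [H] and of the shrunk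
    graph, with laws [mu1] and [mu2]. *)
Definition product_law mu1 mu2 (g : {set E}) : R :=
  if (g :&: H \in spanning_trees core) && (g :\: H \in spanning_trees shr)
  then mu1 (g :&: H) * mu2 (g :\: H) else 0.

Section Product.
Variables mu1 mu2 : {set E} -> R.
Hypotheses (p1 : tree_pmf core mu1) (p2 : tree_pmf shr mu2).

Lemma sum_product_law (c : {set E} -> {set E} -> R) :
  \sum_(g in spanning_trees G) product_law mu1 mu2 g * c (g :&: H) (g :\: H) =
  \sum_(g1 in spanning_trees core) \sum_(g2 in spanning_trees shr)
    mu1 g1 * mu2 g2 * c g1 g2.
Proof.
pose P (g : {set E}) :=
  (g :&: H \in spanning_trees core) && (g :\: H \in spanning_trees shr).
have PT g : P g -> g \in spanning_trees G.
  case/andP=> gI gD; rewrite -(setID g H).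
  exact: (union_spanning_tree HG H0 gI gD).
rewrite (bigID P) /= [X in _ + X]big1 ?addr0 => [|g /andP[_]]; last first.
  by rewrite /product_law /P => /negPf->; rewrite mul0r.
rewrite pair_big /= (reindex_onto (fun p : {set E} * {set E} => p.1 :|: p.2)
  (fun g => (g :&: H, g :\: H))) /= => [|g _]; last exact: setID.
apply: eq_big => [[g1 g2]|[g1 g2]] /=.
  apply/idP/idP => [/andP[/andP[_ /andP[h1 h2]] /eqP[e1 e2]]|/andP[h1 h2]].
    by rewrite e1 in h1; rewrite e2 in h2; rewrite h1 h2.
  by rewrite PT /P ?(union_tree_setI HG h1 h2) ?(union_tree_setD HG h1 h2) ?h1 ?h2 /=.
move=> /andP[/andP[_ /andP[h1 h2]] /eqP[e1 e2]].
by rewrite /product_law h1 h2 /= e1 e2.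
Qed.

Lemma product_law_pmf : tree_pmf G (product_law mu1 mu2).
Proof.
split=> [g _|].
  rewrite /product_law; case: ifP => // /andP[h1 h2].
  by rewrite mulr_ge0 ?(proj1 p1) ?(proj1 p2).
have := sum_product_law (fun _ _ => 1).
under eq_bigr do rewrite mulr1; move=> ->.
under eq_bigr => g1 _ do (under eq_bigr do rewrite mulr1; rewrite -mulr_sumr (proj2 p2) mulr1).
exact: (proj2 p1).
Qed.

Lemma overlap_product : expected_overlap G (product_law mu1 mu2) =
  expected_overlap core mu1 + expected_overlap shr mu2.
Proof.
apply: expected_overlap_split => e eH.
  have := sum_product_law (fun g1 _ => (e \in g1)%:R).
  under eq_bigr do rewrite inE eH andbT; rewrite /usage => ->; apply: eq_bigr => g1 _.
  by rewrite -mulr_suml -mulr_sumr (proj2 p2) mulr1.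
have := sum_product_law (fun _ g2 => (e \in g2)%:R).
under eq_bigr do rewrite inE eH; rewrite /usage => ->; rewrite exchange_big.
apply: eq_bigr => g2 _.
by rewrite -mulr_suml -mulr_suml (proj2 p1) mul1r.
Qed.

End Product.
End Coupling.

(** * Fair trees and densest subgraphs *)

Section FairCore.
Variables (R : realType) (V E : finType) (G : mgraph V E) (H : {set E}).
Hypotheses (hloop : loopless G) (HS : H \in conn_subs G)
  (Hmax : forall F, F \in conn_subs G ->
     density (esub G F) <= density (esub G H)).

Let HG : H \subset edges G. Proof. by have [] := conn_subsP _ _ HS. Qed.
Let H0 : H != set0. Proof. by have [] := conn_subsP _ _ HS. Qed.

Lemma densest_fair_restriction : fair_restriction R G H.
Proof.
move=> g [gT [mu [opt mug]]].
have := support_spans_densest hloop opt HS Hmax gT mug.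
by rewrite inE => /asboolP.
Qed.

Lemma densest_fair_shrink (g : {set E}) :
  fair_tree R G g -> fair_tree R (shrink G H) (g :\: H).
Proof.
move=> [gT [mu [opt mug]]].
have span := support_spans_densest hloop opt HS Hmax; have [pmu min] := opt.
have shrT := span_shrink HG H0 span.
split; first exact: shrT.
exists (shrink_law G H mu); split; last exact: (image_law_gt0 (fun h => h :\: H) pmu gT mug).
split=> [|nu pnu]; first exact: shrink_law_pmf.
have := min _ (product_law_pmf HG H0 (core_law_pmf pmu span) pnu).
rewrite (overlap_split HG H0 pmu span).
rewrite (overlap_product HG H0 (core_law_pmf pmu span) pnu).
by rewrite lerD2l.
Qed.

Lemma densest_fair_coupling (g1 g2 : {set E}) :
  fair_tree R (esub G H) g1 -> fair_tree R (shrink G H) g2 ->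
  fair_tree R G (g1 :|: g2).
Proof.
move=> [g1T [mu1 [[p1 min1] mu1g]]] [g2T [mu2 [[p2 min2] mu2g]]].
have p12 := product_law_pmf HG H0 p1 p2.
split; first exact: (union_spanning_tree HG H0 g1T g2T).
exists (product_law G H mu1 mu2); split; last first.
  rewrite /product_law (union_tree_setI HG g1T g2T) (union_tree_setD HG g1T g2T).
  by rewrite g1T g2T mulr_gt0.
split=> // nu pnu; have [mu opt] := meo_optimal_exists p12.
have span := support_spans_densest hloop opt HS Hmax; have [pmu min] := opt.
apply: le_trans (min nu pnu).
rewrite (overlap_split HG H0 pmu span) (overlap_product HG H0 p1 p2).
apply: lerD; first exact: min1 (core_law_pmf pmu span).
exact: min2 (shrink_law_pmf HG H0 pmu span).
Qed.

End FairCore.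

Theorem theorem8p1 (R : realType) (V E : finType) (G : mgraph V E)
    (hE : edges G != set0) (hloop : loopless G) (hG : biconnected G) :
  (strictly_dense G \/
     exists H0 : {set E}, minimal_core G H0 /\ H0 \proper edges G) /\
  ~ (strictly_dense G /\
       exists H0 : {set E}, minimal_core G H0 /\ H0 \proper edges G) /\
  (forall H0 : {set E}, minimal_core G H0 -> H0 \proper edges G ->
     [/\ fair_restriction R G H0,
         forall g : {set E}, fair_tree R G g ->
           fair_tree R (shrink G H0) (g :\: H0)
       & forall g1 g2 : {set E},
           fair_tree R (esub G H0) g1 -> fair_tree R (shrink G H0) g2 ->
           fair_tree R G (g1 :|: g2)]).
Proof.
have [cG _] := andP hG.
split; first exact: strictly_dense_or_core.
split; first exact: strictly_dense_no_core.
move=> H0 [HS Hmax _] _; split.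
- exact: densest_fair_restriction.
- exact: densest_fair_shrink.
- exact: densest_fair_coupling.
Qed.
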